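(* Let $(q_n)$ be a sequence of positive integers with $q_n\to\infty$ and $q_n/n\to 0$ as $n\to\infty$. Let $X_i=\theta_i+\epsilon_i$, $i=1,\dots,n$, with $\epsilon_i$ i.i.d. $N(0,1)$, and consider testing $H_{0i}:\theta_i=0$ against $H_{1i}:\theta_i\neq0$ simultaneously for $i=1,\dots,n$ with the rule $\boldsymbol\psi=(\psi_1,\dots,\psi_n)$, $$\psi_i=\mathbf 1\Bigl\{\mathbb E(1-\kappa_i\mid X_i,\tau)>\tfrac12\Bigr\},$$ where the posterior shrinkage coefficient $\mathbb E(1-\kappa_i\mid X_i,\tau)$ (defined in the context) is computed under the one-group prior with exponent $a=\tfrac12$ and slowly varying function $L$. Assume that $\tau=\tau_n>0$ satisfies $\tau_n\to0$ and $n\tau_n/q_n\to C$ for some $C\in(0,\infty)$, and that $L$ satisfies (A1) and (A2) of the context. Then for every fixed $b\in\mathbb R$, $$\frac1{q_n}\sup_{\boldsymbol\theta\in\boldsymbol\Theta_b}\mathbb E_{\boldsymbol\theta}\,\mathcal L(\boldsymbol\theta,\boldsymbol\psi)=1-\Phi(b)+o(1)\qquad (n\to\infty),$$ where $\mathcal L$ is the classification loss and $\boldsymbol\Theta_b$ the beta-min class defined in the context. The same conclusion holds with $b$ replaced by any real sequence $b=b_n\to\infty$.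
   Context: One-group shrinkage prior: given $\tau>0$, independently over $i$, $\theta_i\mid\lambda_i,\tau\sim N(0,\lambda_i^2\tau^2)$ and $\lambda_i^2$ has probability density $\pi_1(t)=K\,t^{-a-1}L(t)$ on $(0,\infty)$, where $a>0$, $L:(0,\infty)\to(0,\infty)$ is measurable, continuous and slowly varying (at infinity), and $K>0$ is the normalizing constant; $a$ and $L$ do not depend on $n$. (Horseshoe-type priors are those with $a=\tfrac12$.) Shrinkage coefficient: $\kappa_i=1/(1+\lambda_i^2\tau^2)$, and $\mathbb E(1-\kappa_i\mid X_i,\tau)$ denotes the posterior mean of $1-\kappa_i$ given $X_i$ under this prior and $X_i\mid\theta_i\sim N(\theta_i,1)$; explicitly $$\mathbb E(1-\kappa_i\mid X_i=x,\tau)=\frac{\int_0^\infty \frac{t\tau^2}{1+t\tau^2}(1+t\tau^2)^{-1/2}e^{-x^2/(2(1+t\tau^2))}\,t^{-a-1}L(t)\,dt}{\int_0^\infty (1+t\tau^2)^{-1/2}e^{-x^2/(2(1+t\tau^2))}\,t^{-a-1}L(t)\,dt}.$$ Assumptions on $L$: (A1) there exist $c_0>0$ and $t_0>0$ such that $L(t)\ge c_0$ for all $t\ge t_0$; (A2) there exists $M\in(0,\infty)$ such that $\sup_{t\in(0,\infty)}L(t)\le M$. Beta-min class: for real $b$ (possibly depending on $n$), $\boldsymbol\Theta_b=\{\boldsymbol\theta\in\mathbb R^n:\ |S_{\boldsymbol\theta}|=q_n,\ |\theta_i|\ge\sqrt{2\log(n/q_n)}+b\ \text{for all } i\in S_{\boldsymbol\theta}\}$,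 where $S_{\boldsymbol\theta}=\{i:\theta_i\ne0\}$. Classification (Hamming) loss: $\mathcal L(\boldsymbol\theta,\boldsymbol\psi)=\sum_{i=1}^n\bigl[\mathbf 1\{\theta_i=0,\psi_i\ne0\}+\mathbf 1\{\theta_i\ne0,\psi_i=0\}\bigr]$. $\mathbb E_{\boldsymbol\theta}$ is expectation when the true mean vector is the fixed vector $\boldsymbol\theta$. $\Phi$ is the standard normal distribution function. *)

(* Defs.v *)
From HB Require Import structures.
From mathcomp Require Import all_boot all_order all_algebra.
From mathcomp Require Import all_classical all_reals all_analysis.
Set Implicit Arguments.
Unset Strict Implicit.
Unset Printing Implicit Defensive.
Import Order.TTheory GRing.Theory Num.Theory.
Import numFieldNormedType.Exports.
Local Open Scope classical_set_scope.
Local Open Scope ring_scope.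

Definition slowly_varying (R : realType) (L : R -> R) : Prop :=
  forall c : R, 0 < c -> L (c * t) / L t @[t --> +oo] --> (1 : R).

(* The density of lambda_i^2 on (0, +oo); only the values at t > 0 matter. *)
Definition prior_density (R : realType) (a K : R) (L : R -> R) (t : R) : R :=
  K * t `^ (- a - 1) * L t.

(* Standing conditions on a one-group shrinkage prior; the last one says that
   K is the normalizing constant. *)
Definition one_group_prior (R : realType) (a K : R) (L : R -> R) : Prop :=
  [/\ 0 < a /\ 0 < K,
      forall t : R, 0 < t -> 0 < L t,
      measurable_fun (`]0, +oo[ : set R) L /\
      {within `]0, +oo[, continuous L},
      slowly_varying L &
      (\int[lebesgue_measure]_(t in `]0%R, +oo[) (prior_density a K L t)%:E
        = 1)%E].

(* Up to a factor depending neither on t nor on tau, the density at x of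
   N(0, 1 + t tau^2), i.e. of X_i given lambda_i^2 = t, times the prior
   density of t. The constants cancel in the ratio below. *)
Definition posterior_weight (R : realType) (a : R) (L : R -> R) (tau x t : R)
    : R :=
  (1 + t * tau ^+ 2) `^ (- 2^-1) * expR (- (x ^+ 2 / (2 * (1 + t * tau ^+ 2))))
  * t `^ (- a - 1) * L t.

(* E(1 - kappa_i | X_i = x, tau), where kappa_i = 1 / (1 + lambda_i^2 tau^2) *)
Definition posterior_shrinkage (R : realType) (a : R) (L : R -> R) (tau x : R)
    : R :=
  Rintegral lebesgue_measure `]0, +oo[
    (fun t => t * tau ^+ 2 / (1 + t * tau ^+ 2) * posterior_weight a L tau x t)
  / Rintegral lebesgue_measure `]0, +oo[ (posterior_weight a L tau x).

Definition shrinkage_rule (R : realType) (a : R) (L : R -> R) (tau : R) (n : nat)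
    (X : 'rV[R]_n) : 'rV[bool]_n :=
  \row_i (2^-1 < posterior_shrinkage a L tau (X ord0 i)).

Definition classification_loss (R : realType) (n : nat) (theta : 'rV[R]_n)
    (psi : 'rV[bool]_n) : nat :=
  (\sum_(i < n) (((theta ord0 i == 0%R) && psi ord0 i)
               + ((theta ord0 i != 0%R) && ~~ psi ord0 i)))%N.

Definition support_set (R : realType) (n : nat) (theta : 'rV[R]_n) : {set 'I_n} :=
  [set i | theta ord0 i != 0]%SET.

Definition beta_min_class (R : realType) (n q : nat) (b : R) : set 'rV[R]_n :=
  [set theta | #|support_set theta| = q /\
    forall i, i \in support_set theta ->
      Num.sqrt (2 * ln (n%:R / q%:R)) + b <= `|theta ord0 i| ].

Definition mutually_independent d (T : measurableType d) (R : realType)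
    (P : probability T R) (n : nat) (X : 'I_n -> {RV P >-> R}) : Prop :=
  forall (J : {set 'I_n}) (A : 'I_n -> set R), (forall i, measurable (A i)) ->
    P (\bigcap_(i in [set` J]) (X i @^-1` A i))
      = (\prod_(i in J) P (X i @^-1` A i))%E.

Definition iid_standard_normal d (T : measurableType d) (R : realType)
    (P : probability T R) (n : nat) (X : 'I_n -> {RV P >-> R}) : Prop :=
  mutually_independent X /\
  forall i (A : set R), measurable A ->
    distribution P (X i) A = normal_prob 0 1 A.

(* E_theta L(theta, psi(X)) for X = theta + eps *)
Definition classification_risk d (T : measurableType d) (R : realType)
    (P : probability T R) (n : nat) (eps : 'I_n -> {RV P >-> R})
    (psi : 'rV[R]_n -> 'rV[bool]_n) (theta : 'rV[R]_n) : \bar R :=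
  ('E_P[fun w =>
     (classification_loss theta (psi (\row_i (theta ord0 i + eps i w)%R)))%:R])%E.

Definition std_normal_cdf (R : realType) (x : R) : R :=
  fine (normal_prob 0 1 `]-oo, x]).

(* Main.v *)
Require Import Defs.
From HB Require Import structures.
From mathcomp Require Import all_boot all_order all_algebra.
From mathcomp Require Import all_classical all_reals all_analysis.
From mathcomp Require Import measurable_realfun ring lra.
Set Implicit Arguments.
Unset Strict Implicit.
Unset Printing Implicit Defensive.
Import Order.TTheory GRing.Theory Num.Theory.
Import numFieldNormedType.Exports.
Local Open Scope classical_set_scope.
Local Open Scope ring_scope.

(* The rule rejects at x iff the integral of
     (s - 1) / (s + 1) * posterior_weight,   s = t tau^2,
   is positive. Multiplied by exp (x^2 / 4), the integrand is nondecreasing in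
   |x| whatever the sign of s - 1, so the rule is a threshold rule in |x|.
   With x_n = sqrt (2 log (n / q_n)), the mass on s > 1 is of order tau / x^2
   and the mass on s < 1 of order exp (- x^2 / 2) for x near x_n, where
   exp (- x_n^2 / 2) = q_n / n is of order tau; hence for every e > 0 the
   threshold eventually lies in [x_n, x_n + e]. The Mills bound
   P (|Z| >= x_n) <= 2 exp (- x_n^2 / 2) / x_n makes the type I contribution
   O(1 / x_n), and the type II contribution is squeezed between
   1 - Phi b - O(1 / x_n) and 1 - Phi b + e, uniformly in b. *)

(** * Standard normal law: reflection, tail and short-interval bounds *)

Section standard_normal.
Context {R : realType}.
Notation mu := (@lebesgue_measure R).
Notation stdN := (@normal_prob R 0 1).

Lemma std_normal_pdfE (x : R) :
  normal_pdf 0 1 x = normal_peak 1 * expR (- (x ^+ 2 / 2)).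
Proof. by rewrite normal_pdfE ?oner_neq0// /normal_fun subr0 expr1n mulNr. Qed.

Lemma normal_peak1_le1 : normal_peak (1 : R) <= 1.
Proof.
rewrite /normal_peak invf_le1; last first.
  by rewrite sqrtr_gt0 mulrn_wgt0// mulr_gt0 ?pi_gt0// exprn_gt0.
rewrite -[X in X <= _]sqrtr1 ler_wsqrtr// expr1n mul1r -mulr_natr.
by have := pi_ge2 R; lra.
Qed.

Lemma std_normal_probN (A : set R) :
  measurable A -> stdN [set z | A (- z)] = stdN A.
Proof.
move=> mA; rewrite /normal_prob.
transitivity (\int[mu]_(x in (-%R : _ -> measurableTypeR R) @^-1` A)
    (normal_pdf 0 1 (- x))%:E)%E.
  by apply: eq_integral => x _; rewrite !std_normal_pdfE sqrrN.
rewrite -(@ge0_integral_pushforward _ _ _ (measurableTypeR R) _ _ _ _ _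
  (fun x => (normal_pdf 0 1 x)%:E))//=.
- symmetry; apply: eq_measure_integral => B mB _.
  exact: (esym (lebesgue_measureN mB)).
- by apply/measurable_EFinP/measurable_funTS; exact: measurable_normal_pdf.
- by move=> x _; rewrite lee_fin normal_pdf_ge0.
Qed.

(** For [t >= x] the factor [t / x] is at least 1. Inserting it into the density gives [f], which
    has the explicit primitive [F] vanishing at infinity; the normalizing factor is bounded by 1. *)
Lemma std_normal_prob_tail (x : R) : 0 < x ->
  (stdN `[x, +oo[ <= (expR (- (x ^+ 2 / 2)) / x)%:E)%E.
Proof.
move=> x0; pose F (t : R) : R := - (x^-1 * expR (- (t ^+ 2 / 2))).
pose f (t : R) : R := t / x * expR (- (t ^+ 2 / 2)).
have dF (t : R) : is_derive t 1 F (f t).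
  rewrite /F /f; apply: is_derive_eq.
  by rewrite /GRing.scale/=; field; rewrite gt_eqF.
have cf : continuous f.
  move=> t; apply: cvgM; first by apply: cvgM; [exact: cvg_id|exact: cvg_cst].
  apply: (cvg_comp _ expR); last exact: continuous_expR.
  apply: (@cvgN _ R^o); apply: cvgM; last exact: cvg_cst.
  exact: sqr_continuous.
have -> : expR (- (x ^+ 2 / 2)) / x = 0 - F x by rewrite /F; ring.
rewrite EFinB -(@ge0_continuous_FTC2y R f F x 0).
- apply: ge0_le_integral => //=.
  + by move=> t _; rewrite lee_fin normal_pdf_ge0.
  + by apply/measurable_EFinP/measurable_funTS; exact: measurable_normal_pdf.
  + apply/measurable_EFinP/measurable_funTS.
    exact: continuous_measurable_fun.
  + move=> t; rewrite in_itv/= andbT => xt; rewrite lee_fin std_normal_pdfE /f.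
    apply: ler_pM; rewrite ?expR_ge0 ?normal_peak_ge0//.
    apply: (le_trans normal_peak1_le1).
    by rewrite ler_pdivlMr// mul1r.
- move=> t xt; rewrite mulr_ge0 ?expR_ge0// divr_ge0 ?(ltW x0)//.
  by rewrite (le_trans _ xt)// ltW.
- exact: continuous_subspaceT.
- rewrite -oppr0; apply: cvgN; rewrite -(mulr0 x^-1); apply: cvgMr.
  apply: (squeeze_cvgr _ (cvg_cst 0) (@cvgr_expR R)).
  near=> t; rewrite expR_ge0/= ler_expR lerN2.
  have t2 : 2 <= t by near: t; exact: nbhs_pinfty_ge.
  by rewrite ler_pdivlMr// expr2 ler_pM2l// (lt_le_trans _ t2).
- by move=> t _; have [] := dF t.
- apply: cvg_at_right_filter. apply: differentiable_continuous.
  by apply/derivable1_diffP; have [] := dF x.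
- by move=> t _; rewrite derive1E; have [_ ->] := dF t.
Unshelve. all: by end_near. Qed.

(** The density is at most 1. This prices the gap [e] between the two points that bracket the
    threshold. *)
Lemma std_normal_prob_itv_le (a b : R) : a <= b ->
  (stdN `[a, b[ <= (b - a)%:E)%E.
Proof.
move=> ab; apply: (@le_trans _ _ (\int[mu]_(x in `[a, b[) (cst 1%:E) x)%E).
  apply: ge0_le_integral => //=.
  - by move=> t _; rewrite lee_fin normal_pdf_ge0.
  - by apply/measurable_EFinP/measurable_funTS; exact: measurable_normal_pdf.
  - move=> t _; rewrite lee_fin (le_trans (normal_pdf_ub _ _ _))//.
    exact: normal_peak1_le1.
rewrite integral_cst//= lebesgue_measure_itv/= lte_fin mul1e.
by move: ab; rewrite le_eqVlt => /predU1P[->|->]; rewrite ?ltxx ?subrr.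
Qed.

(** This is the probability that noise drags a mean [x0 + b] below [x0], the limiting type II error;
    reflection turns the complement of the distribution function into it. *)
Lemma std_normal_prob_lowerE (b : R) :
  stdN `]-oo, (- b)[ = (1 - std_normal_cdf b)%:E.
Proof.
rewrite EFinB fineK ?fin_num_measure//.
transitivity (stdN (~` `]-oo, b])); last exact: probability_setC.
rewrite -[RHS]std_normal_probN; last exact: measurableC.
congr (stdN _); apply/seteqP; split => z; rewrite /= !in_itv/=.
- by move=> zb; apply/negP; rewrite -ltNge ltrNr.
- by move=> /negP; rewrite -ltNge ltrNr.
Qed.

End standard_normal.

(** * Error probabilities of a rule monotone in the absolute value *)

Section threshold_rule.
Context {R : realType}.
Notation stdN := (@normal_prob R 0 1).
Variable r : R -> bool.
Hypothesis r_mono : forall x y, `|x| <= `|y| -> r x -> r y.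

(** Monotonicity in the absolute value makes the acceptance region an interval: a point between two
    accepted ones is no farther from 0 than one of them. *)
Lemma measurable_acceptance (c : R) : measurable [set z : R | ~~ r (c + z)].
Proof.
apply: is_interval_measurable => x y /= rx ry z /andP[xz zy].
apply/negP => rz.
have [cz|cz] := leP 0 (c + z).
- move/negP: ry; apply; apply: r_mono rz.
  by rewrite ger0_norm//; apply: le_trans (ler_norm _); rewrite lerD2l.
- move/negP: rx; apply; apply: r_mono rz.
  by rewrite ltr0_norm// -normrN; apply: le_trans (ler_norm _); rewrite lerN2 lerD2l.
Qed.

Lemma measurable_rejection (c : R) : measurable [set z : R | r (c + z)].
Proof.
rewrite (_ : [set _ | _] = ~` [set z : R | ~~ r (c + z)]).
  by apply: measurableC; exact: measurable_acceptance.
by apply/seteqP; split => z /=; [move=> ->|move/negP; rewrite negbK].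
Qed.

(** Acceptance forces [theta + z] inside the radius [x0 + e], so the noise, taken with the sign of
    [theta], lies below [e - b]. The part below [- b] has probability [1 - std_normal_cdf b], and
    the remaining interval has length [e]. *)
Lemma acceptance_prob_le (theta x0 b e : R) : 0 <= x0 -> 0 <= e -> r (x0 + e) ->
  x0 + b <= `|theta| ->
  (stdN [set z | ~~ r (theta + z)%R] <= (1 - std_normal_cdf b + e)%:E)%E.
Proof.
move=> x00 e0 rxe xb.
have close z : ~~ r (theta + z) -> `|theta + z| < x0 + e.
  move=> /negP nr; rewrite ltNge; apply/negP => h; apply: nr.
  by apply: r_mono rxe; rewrite ger0_norm ?addr_ge0.
pose B : set R := `]-oo, e - b[%classic.
have mB : measurable B by exact: measurable_itv.
have mB' : measurable [set z | B (- z)].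
  rewrite (_ : [set _ | _] = `]b - e, +oo[%classic)//.
  by apply/seteqP; split => z; rewrite /B/= !in_itv/= ?andbT; lra.
have le1 : (stdN [set z | ~~ r (theta + z)%R] <= stdN B)%E.
  have [t0|t0] := leP 0 theta; last rewrite -(@std_normal_probN _ B)//.
  - apply: le_measure; rewrite ?inE//=; first exact: measurable_acceptance.
    move=> z /= /close h; rewrite /B/= in_itv/=; move: xb; rewrite ger0_norm// => xb.
    have := ler_norm (theta + z); lra.
  - apply: le_measure; rewrite ?inE//=; first exact: measurable_acceptance.
    move=> z /= /close h; rewrite /B/= in_itv/=; move: xb; rewrite ltr0_norm// => xb.
    have := ler_norm (- (theta + z)); rewrite normrN; lra.
apply: (le_trans le1); rewrite EFinD -std_normal_prob_lowerE.
rewrite (_ : B = `]-oo, - b[%classic `|` `[- b, e - b[%classic); last first.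
  apply/seteqP; split => z; rewrite /B/= !in_itv/=; last by case; lra.
  by move=> zeb; have [zb|zb] := ltP z (- b); [left|right; lra].
apply: (le_trans (measureU2 _ _ _)) => //; apply: leeD => //.
rewrite [X in (_ <= X%:E)%E](_ : e = e - b - - b); last by ring.
by apply: (@std_normal_prob_itv_le _ (- b) (e - b)); lra.
Qed.

Lemma rejection_prob_le (x0 : R) : 0 < x0 -> ~~ r x0 ->
  (stdN [set z | r z] <= (2 * (expR (- (x0 ^+ 2 / 2)) / x0))%:E)%E.
Proof.
move=> x00 nr; have -> : [set z | r z] = [set z | r (0 + z)].
  by apply/seteqP; split => z /=; rewrite add0r.
pose B : set R := `[x0, +oo[%classic.
have mB : measurable B by exact: measurable_itv.
have mB' : measurable [set z | B (- z)].
  rewrite (_ : [set _ | _] = `]-oo, - x0]%classic)//.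
  by apply/seteqP; split => z; rewrite /B/= !in_itv/= ?andbT; lra.
have NB : (stdN [set z | B (- z)%R] <= (expR (- (x0 ^+ 2 / 2)) / x0)%:E)%E.
  by rewrite std_normal_probN//; exact: std_normal_prob_tail.
apply: (@le_trans _ _ (stdN (B `|` [set z | B (- z)]))).
  apply: le_measure; rewrite ?inE//=.
  - exact: measurable_rejection.
  - exact: measurableU.
  - move=> z /=; rewrite add0r /B/= !in_itv/= !andbT => rz.
    apply/orP; rewrite -ler_normr leNgt; apply/negP => zx.
    by move/negP: nr; apply; apply: r_mono rz; rewrite (ger0_norm (ltW x00)) ltW.
apply: (le_trans (measureU2 _ _ _)) => //.
by rewrite mulrDl !mul1r EFinD; apply: leeD NB; exact: std_normal_prob_tail.
Qed.

(** With the mean at the boundary of the class, noise [z < - b] keeps the observation below [x0]. It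
    also stays above [- x0] unless [z <= - x0], and that event is paid for by a Mills tail. *)
Lemma acceptance_prob_ge (x0 b : R) : 0 < x0 -> 0 <= x0 + b -> ~~ r x0 ->
  ((1 - std_normal_cdf b - expR (- (x0 ^+ 2 / 2)) / x0)%:E
     <= stdN [set z | ~~ r (x0 + b + z)%R])%E.
Proof.
move=> x00 xb nr; rewrite EFinB -std_normal_prob_lowerE leeBlDr//.
pose B : set R := `[x0, +oo[%classic.
have mB : measurable B by exact: measurable_itv.
have mB' : measurable [set z | B (- z)].
  rewrite (_ : [set _ | _] = `]-oo, - x0]%classic)//.
  by apply/seteqP; split => z; rewrite /B/= !in_itv/= ?andbT; lra.
have NB : (stdN [set z | B (- z)%R] <= (expR (- (x0 ^+ 2 / 2)) / x0)%:E)%E.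
  by rewrite std_normal_probN//; exact: std_normal_prob_tail.
apply: (@le_trans _ _
  (stdN ([set z | ~~ r (x0 + b + z)%R] `|` [set z | B (- z)]))).
  apply: le_measure; rewrite ?inE//=.
    by apply: measurableU => //; exact: measurable_acceptance.
  move=> z /=; rewrite in_itv/= => zb.
  have [zx|zx] := leP z (- x0); [right|left].
    by rewrite /B/= in_itv/= andbT; lra.
  apply: contraNN nr => rz; apply: r_mono rz.
  by rewrite (ger0_norm (ltW x00)) ler_norml; lra.
apply: (le_trans (measureU2 _ _ _)) => //.
  exact: measurable_acceptance.
exact: leeD NB.
Qed.

(** * Supremum of the risk over the beta-min class *)

Section risk.
Context d (T : measurableType d) (P : probability T R) (n : nat).
Variable eps : 'I_n -> {RV P >-> R}.
Hypothesis iid : iid_standard_normal eps.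

Let psi (X : 'rV[R]_n) : 'rV[bool]_n := \row_i r (X ord0 i).

(** The loss of a coordinate is the indicator of an event in its own noise variable, so linearity of
    expectation reduces the risk to marginal laws. *)
Lemma threshold_riskE (theta : 'rV[R]_n) :
  classification_risk eps psi theta =
  (\sum_(i < n) if theta ord0 i == 0%R then stdN [set z | r z]
                else stdN [set z | ~~ r (theta ord0 i + z)%R])%E.
Proof.
pose E i : set R := if theta ord0 i == 0 then [set z | r z]
                else [set z | ~~ r (theta ord0 i + z)].
have mE i : measurable (E i).
  rewrite /E; case: ifP => _; last exact: measurable_acceptance.
  rewrite (_ : mkset _ = [set z | r (0 + z)]); first exact: measurable_rejection.
  by apply/seteqP; split => z /=; rewrite add0r.
rewrite /classification_risk unlock.
transitivity (\int[P]_w (\sum_(i < n) (\1_(eps i @^-1` E i) w)%:E))%E.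
  apply: eq_integral => w _; rewrite /classification_loss natr_sum -sumEFin.
  apply: eq_bigr => i _; congr EFin; rewrite indicE !mxE /E /preimage.
  case: ifPn => [/eqP ->|t0] /=.
    by rewrite add0r addn0 mem_setE; congr (nat_of_bool _)%:R; apply/idP/idP.
  by rewrite mem_setE.
rewrite ge0_integral_sum//=; last first.
  move=> i; apply/measurable_EFinP; apply: measurable_indic.
  by rewrite -[X in measurable X]setTI; exact: measurable_funP.
apply: eq_bigr => i _; rewrite integral_indic//= ?setIT; last first.
  by rewrite -[X in measurable X]setTI; exact: measurable_funP.
rewrite -[LHS]/(distribution P (eps i) (E i)) iid.2// /E.
by case: ifP.
Qed.

Lemma threshold_sup_risk_le (q : nat) (b e : R) :
  let x0 := Num.sqrt (2 * ln (n%:R / q%:R)) in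
  0 < x0 -> 0 <= e -> ~~ r x0 -> r (x0 + e) ->
  (ereal_sup [set classification_risk eps psi theta
             | theta in @beta_min_class R n q b] <=
   (n%:R * (2 * (expR (- (x0 ^+ 2 / 2)) / x0))
     + q%:R * (1 - std_normal_cdf b + e))%:E)%E.
Proof.
move=> x0 x00 e0 nr rxe; apply: ge_ereal_sup => _ [theta [tq tb] <-].
rewrite threshold_riskE; set t := 2 * _; set p := 1 - _ + _.
have t0 : 0 <= t by rewrite mulr_ge0// divr_ge0 ?expR_ge0// ltW.
have p0 : 0 <= p.
  rewrite /p addr_ge0// subr_ge0 /std_normal_cdf -lee_fin fineK ?fin_num_measure//.
  exact: probability_le1.
(* The type I bound [t] is charged to all [n] coordinates, including those in the support; this
   makes the sum explicit at no cost in order. *)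
apply: (@le_trans _ _ (\sum_(i < n)
    (t + if i \in support_set theta then p else 0)%:E)%E).
  apply: lee_sum => i _; rewrite inE; case: ifPn => ti /=.
    by rewrite addr0; exact: rejection_prob_le.
  apply: (le_trans (acceptance_prob_le (b := b) (ltW x00) e0 rxe _)).
    by apply: tb; rewrite inE.
  by rewrite lee_fin lerDr.
rewrite sumEFin lee_fin big_split/= sumr_const card_ord -big_mkcond/=.
by rewrite sumr_const tq !mulr_natl.
Qed.

(** The supremum is tested at one configuration: [q] means exactly at the boundary [x0 + b], the
    others 0. Its type I errors are bounded below by 0. *)
Lemma threshold_sup_risk_ge (q : nat) (b : R) : (q <= n)%N ->
  let x0 := Num.sqrt (2 * ln (n%:R / q%:R)) in
  0 < x0 -> 0 < x0 + b -> ~~ r x0 ->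
  ((q%:R * (1 - std_normal_cdf b - expR (- (x0 ^+ 2 / 2)) / x0))%:E <=
   ereal_sup [set classification_risk eps psi theta
             | theta in @beta_min_class R n q b])%E.
Proof.
move=> qn x0 x00 xb nr; set p := 1 - _ - _.
pose theta : 'rV[R]_n := \row_i (if (i < q)%N then x0 + b else 0).
have thetaE i : (theta ord0 i == 0) = ~~ (i < q)%N.
  by rewrite mxE; case: ifP => _; rewrite ?eqxx// gt_eqF.
have cardS : #|support_set theta| = q.
  have inj : injective (widen_ord qn).
    by move=> i j /(congr1 val) /= ij; exact: val_inj.
  rewrite -[RHS]card_ord -(card_imset _ inj).
  apply: eq_card => i; rewrite inE thetaE negbK.
  apply/idP/imsetP => [iq|[j _ ->]]//=.
  by exists (Ordinal iq) => //; apply: val_inj.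
apply: (@le_trans _ _ (classification_risk eps psi theta)); last first.
  apply: ereal_sup_ubound; exists theta => //; split => // i.
  by rewrite inE thetaE negbK mxE => ->; exact: ler_norm.
rewrite threshold_riskE.
apply: (@le_trans _ _ (\sum_(i < n)
    (if i \in support_set theta then p else 0)%:E)%E).
  by rewrite sumEFin lee_fin -big_mkcond/= sumr_const cardS mulr_natl.
apply: lee_sum => i _; rewrite inE thetaE negbK mxE; case: ifPn => iq /=.
  by apply: acceptance_prob_ge => //; exact: ltW.
by [].
Qed.

End risk.

End threshold_rule.

(** * Integrals and powers of the comparison functions for the posterior *)

Lemma integrable_scale {R : realType} d (T : measurableType d)
    (mu : {measure set T -> \bar R}) (A : set T) (c : R) (f : T -> R) :
  measurable A -> mu.-integrable A (EFin \o f) ->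
  mu.-integrable A (EFin \o (fun t => c * f t)).
Proof.
move=> mA intf.
rewrite (_ : _ \o _ = (fun t => c%:E * (EFin \o f) t)%E); last exact/funext.
exact: integrableZl.
Qed.

Lemma integrable_add {R : realType} d (T : measurableType d)
    (mu : {measure set T -> \bar R}) (A : set T) (f g : T -> R) :
  measurable A -> mu.-integrable A (EFin \o f) ->
  mu.-integrable A (EFin \o g) ->
  mu.-integrable A (EFin \o (fun t => f t + g t)).
Proof.
move=> mA intf intg.
rewrite (_ : _ \o _ = (EFin \o f) \+ (EFin \o g))%E; last exact/funext.
exact: integrableD.
Qed.

Section powR_facts.
Context {R : realType}.
Implicit Types x y r : R.

Lemma le0_ler_powR x y r : r <= 0 -> 0 < x -> x <= y -> y `^ r <= x `^ r.
Proof.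
move=> r0 x0 xy; have y0 := lt_le_trans x0 xy.
by rewrite /powR !gt_eqF// ler_expR ler_wnM2l// ler_ln ?posrE.
Qed.

(** At squares the half-integer exponents become integer ones, which is why later comparison points
    are written as squares. *)
Lemma powR_sqrN x : 0 < x -> (x ^+ 2) `^ (- 2^-1) = x^-1.
Proof.
move=> x0; rewrite -powR_mulrn ?ltW// -powRrM.
by rewrite (_ : 2%:R * - 2^-1 = - 1) ?powR_inv1 ?ltW//; field.
Qed.

Lemma powR_sqrN3 x : 0 < x -> (x ^+ 2) `^ (- 2^-1 - 1) = (x ^+ 3)^-1.
Proof.
move=> x0; have x20 : 0 < x ^+ 2 by rewrite exprn_gt0.
rewrite powRD; last by rewrite (gt_eqF x20) implybT.
rewrite powR_sqrN// powR_inv1 ?ltW//.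
by field; rewrite gt_eqF.
Qed.

End powR_facts.

Section lebesgue_facts.
Context {R : realType}.
Notation mu := (@lebesgue_measure R).
Notation D := (`]0, +oo[%classic : set R).

Lemma integrable_indic_oc (u v c : R) :
  mu.-integrable D (EFin \o (fun t => c * \1_(`]u, v]) t)).
Proof.
apply: integrable_scale => //.
apply: (integrableS measurableT) => //.
exact: integrable_indic_itv.
Qed.

Lemma Rintegral_indic_oc (u v c : R) : 0 <= u -> u <= v ->
  \int[mu]_(t in D) (c * \1_(`]u, v]) t) = c * (v - u).
Proof.
move=> u0 uv; rewrite RintegralZl//; last first.
  rewrite (_ : \1_(`]u, v]) = (fun t => 1 * \1_(`]u, v]) t)).
    exact: integrable_indic_oc.
  by apply/funext => t; rewrite mul1r.
congr (_ * _); rewrite /Rintegral integral_indic//=.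
rewrite (_ : _ `&` _ = `]u, v]%classic).
  rewrite lebesgue_measure_itv/= lte_fin.
  by move: uv; rewrite le_eqVlt => /predU1P[->|->]; rewrite ?ltxx ?subrr.
apply/seteqP; split => t /=; first by case.
by rewrite !in_itv/= => /andP[ut tv]; rewrite ut tv (le_lt_trans u0).
Qed.

Lemma integral_inv_sqr (B : R) : 0 < B ->
  (\int[mu]_(t in `[B, +oo[) ((t ^+ 2)^-1)%:E = (B^-1)%:E)%E.
Proof.
move=> B0; pose F (t : R) : R := - t^-1.
have -> : B^-1 = 0 - F B by rewrite /F; ring.
have dF (t : R) : 0 < t -> is_derive t 1 F ((t ^+ 2)^-1).
  move=> t0; have t0' : t != 0 by rewrite gt_eqF.
  have dV : is_derive t 1 (fun t : R => t^-1) (- (t ^+ 2)^-1).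
    apply: DeriveDef; first exact: (@derivableV _ _ id).
    by rewrite (@deriveV _ _ id)// derive_id /GRing.scale/= mulr1.
  by rewrite -[X in is_derive _ _ _ X]opprK; exact: is_deriveN.
rewrite EFinB; apply: (@ge0_continuous_FTC2y R _ F B 0).
- by move=> t _; rewrite invr_ge0 sqr_ge0.
- apply: continuous_in_subspaceT => t; rewrite inE/= in_itv/= andbT => Bt.
  apply: cvgV; last exact: sqr_continuous.
  by rewrite sqrf_eq0 gt_eqF// (lt_le_trans B0).
- rewrite -oppr0; apply: cvgN; apply/gtr0_cvgV0; last exact: cvg_id.
  by near=> t; near: t; exact: nbhs_pinfty_gt.
- by move=> t Bt; have [] := dF t (lt_trans B0 Bt).
- apply: cvg_at_right_filter. apply: differentiable_continuous.
  by apply/derivable1_diffP; have [] := dF B B0.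
- by move=> t; rewrite in_itv/= andbT => Bt; rewrite derive1E;
    have [_ ->] := dF t (lt_trans B0 Bt).
Unshelve. all: by end_near. Qed.

(** The truncation is an indicator factor, so that all comparison functions are integrated over the
    same domain [D] and can be added pointwise. *)
Let inv_sqr_above (B t : R) := (t ^+ 2)^-1 * \1_(`]B, +oo[) t.

Let integral_inv_sqr_above (B : R) : 0 < B ->
  (\int[mu]_(t in D) (inv_sqr_above B t)%:E = (B^-1)%:E)%E.
Proof.
move=> B0; rewrite -integral_inv_sqr//.
have mg : measurable_fun `]B, +oo[ (fun t : R => (t ^+ 2)^-1).
  apply: open_continuous_measurable_fun => // t; rewrite inE/= in_itv/= andbT.
  move=> Bt; apply: cvgV; last exact: sqr_continuous.
  by rewrite sqrf_eq0 gt_eqF// (lt_trans B0).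
rewrite -integral_itv_obnd_cbnd; last exact/measurable_EFinP.
rewrite -(_ : D `&` `]B, +oo[%classic = `]B, +oo[%classic); last first.
  apply/seteqP; split => t /=; first by case.
  by rewrite !in_itv/= !andbT => Bt; rewrite (lt_trans B0).
rewrite integral_mkcondr; apply: eq_integral => t _.
rewrite /inv_sqr_above patchE indicE mem_setE.
by case: ifPn; rewrite ?mulr1 ?mulr0.
Qed.

Let minv_sqr_above (B : R) : 0 < B -> measurable_fun D (inv_sqr_above B).
Proof.
move=> B0; apply: measurable_funM; last exact: measurable_indic.
apply: open_continuous_measurable_fun => // t; rewrite inE/= in_itv/= andbT.
move=> t0; apply: cvgV; last exact: sqr_continuous.
by rewrite sqrf_eq0 gt_eqF.
Qed.

Lemma integrable_inv_sqr_above (B c : R) : 0 < B ->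
  mu.-integrable D (EFin \o (fun t => c * ((t ^+ 2)^-1 * \1_(`]B, +oo[) t))).
Proof.
move=> B0; apply: integrable_scale => //; apply/integrableP; split.
  by apply/measurable_EFinP; exact: minv_sqr_above.
rewrite (_ : (\int[mu]_(x in D) _)%E = (B^-1)%:E) ?ltry//.
rewrite -integral_inv_sqr_above//; apply: eq_integral => t _ /=.
by rewrite ger0_norm// mulr_ge0// invr_ge0 sqr_ge0.
Qed.

Lemma Rintegral_inv_sqr_above (B c : R) : 0 < B ->
  \int[mu]_(t in D) (c * ((t ^+ 2)^-1 * \1_(`]B, +oo[) t)) = c * B^-1.
Proof.
move=> B0; rewrite RintegralZl//.
  by rewrite /Rintegral integral_inv_sqr_above.
have := integrable_inv_sqr_above 1 B0.
rewrite (_ : (fun _ => 1 * _) = inv_sqr_above B)//.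
by apply/funext => t; rewrite mul1r.
Qed.

End lebesgue_facts.

(** * The posterior integral, its sign and its monotonicity *)

Section posterior.
Context {R : realType}.
Notation mu := (@lebesgue_measure R).
Notation D := (`]0, +oo[%classic : set R).
Variables (K : R) (L : R -> R) (tau : R).
Implicit Types x y t : R.
Hypotheses (prior : one_group_prior 2^-1 K L) (tau0 : 0 < tau).

Let p (t : R) : R := t `^ (- 2^-1 - 1) * L t.
Notation w := (posterior_weight 2^-1 L tau).
(** With [s = t * tau ^+ 2], the identity [s / (1 + s) - 1 / 2 = (s - 1) / (2 * (s + 1))] makes this
    twice the integrand of the numerator minus half the denominator. *)
Let excess (x t : R) : R := (t * tau ^+ 2 - 1) / (t * tau ^+ 2 + 1) * w x t.

Let K0 : 0 < K. Proof. by have [[]] := prior. Qed.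

Let L0 t : 0 < t -> 0 < L t. Proof. by have [_ + _ _ _] := prior; exact. Qed.

Let p_ge0 t : 0 < t -> 0 <= p t.
Proof. by move=> t0; rewrite mulr_ge0 ?powR_ge0// ltW// L0. Qed.

Let mp : measurable_fun D p.
Proof.
apply: measurable_funM; first by apply: measurable_funTS; exact: measurable_powR.
by have [_ _ []] := prior.
Qed.

Let integral_p : (\int[mu]_(t in D) (p t)%:E = K^-1%:E)%E.
Proof.
have [_ _ _ _ h] := prior.
have -> : K^-1%:E = (K^-1%:E * 1)%E by rewrite mule1.
rewrite -h -ge0_integralZl//=.
- apply: eq_integral => t _; rewrite -EFinM; congr EFin.
  by rewrite /prior_density /p; field; rewrite gt_eqF.
- apply/measurable_EFinP; rewrite /prior_density.
  rewrite (_ : (fun _ => _) = (fun t => K * p t)); last first.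
    by apply/funext => t; rewrite /p mulrA.
  by apply: measurable_funM.
- move=> t; rewrite in_itv/= andbT => t0; rewrite lee_fin /prior_density -mulrA.
  by apply: mulr_ge0; [exact: ltW|exact: p_ge0].
- by rewrite lee_fin invr_ge0 ltW.
Qed.

Let integrable_p : mu.-integrable D (EFin \o p).
Proof.
apply/integrableP; split; first exact/measurable_EFinP.
rewrite (_ : (\int[mu]_(x in D) _)%E = K^-1%:E) ?ltry// -integral_p.
apply: eq_integral => t; rewrite inE/= in_itv/= andbT => t0.
by rewrite ger0_norm// p_ge0.
Qed.

Let Rintegral_p : \int[mu]_(t in D) p t = K^-1.
Proof. by rewrite /Rintegral integral_p. Qed.

Let factor (x t : R) : R :=
  (1 + t * tau ^+ 2) `^ (- 2^-1) * expR (- (x ^+ 2 / (2 * (1 + t * tau ^+ 2)))).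

Let weightE x t : w x t = factor x t * p t.
Proof. by rewrite /posterior_weight /factor /p mulrA. Qed.

Let s_gt0 t : 0 < t -> 0 < t * tau ^+ 2.
Proof. by move=> t0; rewrite mulr_gt0// exprn_gt0. Qed.

Let s1_gt0 t : 0 < t -> 0 < 1 + t * tau ^+ 2.
Proof. by move=> t0; rewrite addr_gt0// s_gt0. Qed.

Let powR_s_le1 t : 0 < t -> (1 + t * tau ^+ 2) `^ (- 2^-1) <= 1.
Proof.
move=> t0; apply: (@le_trans _ _ (1 `^ (- 2^-1))); last by rewrite powR1.
by apply: le0_ler_powR => //; rewrite lerDl ltW// s_gt0.
Qed.

Let expR_s_le1 x t : 0 < t ->
  expR (- (x ^+ 2 / (2 * (1 + t * tau ^+ 2)))) <= 1.
Proof.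
move=> t0; rewrite -[leRHS]expR0 ler_expR oppr_le0 divr_ge0 ?sqr_ge0//.
by apply: mulr_ge0 => //; apply: ltW; exact: s1_gt0.
Qed.

Let factor_ge0 x t : 0 <= factor x t.
Proof. by rewrite mulr_ge0 ?powR_ge0 ?expR_ge0. Qed.

Let factor_le_exp x t : 0 < t ->
  factor x t <= expR (- (x ^+ 2 / (2 * (1 + t * tau ^+ 2)))).
Proof. by move=> t0; rewrite ler_piMl ?expR_ge0 ?powR_s_le1. Qed.

Let factor_le1 x t : 0 < t -> factor x t <= 1.
Proof. by move=> t0; exact: le_trans (factor_le_exp _ _) (expR_s_le1 _ _). Qed.

Let mpowR_s r : measurable_fun D (fun t => (1 + t * tau ^+ 2) `^ r).
Proof.
apply: measurable_funTS; apply: (measurableT_comp (measurable_powR r)).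
by apply: measurable_funD => //; exact: measurable_funM.
Qed.

Let inv_sE t : 0 < t -> (1 + t * tau ^+ 2)^-1 = (1 + t * tau ^+ 2) `^ (- 1).
Proof. by move=> t0; rewrite powR_inv1// ltW// s1_gt0. Qed.

Let integrable_bounded_p (f : R -> R) : measurable_fun D f ->
  (forall t, 0 < t -> `|f t| <= p t) -> mu.-integrable D (EFin \o f).
Proof.
move=> mf fp; apply: (le_integrable _ _ _ integrable_p) => //.
  exact/measurable_EFinP.
move=> t; rewrite /= in_itv/= andbT => t0; rewrite lee_fin.
by rewrite (ger0_norm (p_ge0 t0)) fp.
Qed.

Let mweight x : measurable_fun D (w x).
Proof.
rewrite (_ : w x = (fun t => factor x t * p t)); last first.
  by apply/funext => t; rewrite weightE.
apply: measurable_funM => //; apply: measurable_funM => //.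
apply: (measurableT_comp (@measurable_expR R)).
(* The reciprocal is traded for the power [- 1], which agrees with it on [D] and is covered by
   [mpowR_s]. *)
have mf : measurable_fun D
    (fun t : R => - (x ^+ 2 / 2) * (1 + t * tau ^+ 2) `^ (- 1)).
  exact: measurable_funM.
apply: eq_measurable_fun mf => t; rewrite inE/= in_itv/= andbT => t0.
by rewrite -inv_sE// invfM; ring.
Qed.

Let weight_ge0 x t : 0 < t -> 0 <= w x t.
Proof. by move=> t0; rewrite weightE mulr_ge0// p_ge0. Qed.

Let weight_le x t : 0 < t -> w x t <= p t.
Proof. by move=> t0; rewrite weightE ler_piMl ?p_ge0 ?factor_le1. Qed.

Let integrable_weight x : mu.-integrable D (EFin \o w x).
Proof.
apply: integrable_bounded_p => // t t0.
by rewrite ger0_norm ?weight_ge0// weight_le.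
Qed.

Let mexcess x : measurable_fun D (excess x).
Proof.
apply: measurable_funM => //.
have mf : measurable_fun D
    (fun t : R => 1 - 2 * (1 + t * tau ^+ 2) `^ (- 1)).
  by apply: measurable_funB => //; exact: measurable_funM.
apply: eq_measurable_fun mf => t; rewrite inE/= in_itv/= andbT => t0.
rewrite -inv_sE//; have s1 := s1_gt0 t0; field.
by rewrite addrC gt_eqF.
Qed.

Let ratio_ge t : 0 < t ->
   -1 <= (t * tau ^+ 2 - 1) / (t * tau ^+ 2 + 1) <= 1.
Proof.
move=> t0; have s0 := s_gt0 t0.
by rewrite ler_pdivlMr ?ler_pdivrMr ?addr_gt0//; lra.
Qed.

Let integrable_excess x : mu.-integrable D (EFin \o excess x).
Proof.
apply: integrable_bounded_p => // t t0.
rewrite normrM (ger0_norm (weight_ge0 _ t0)).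
apply: le_trans (weight_le x t0).
by rewrite ler_piMl ?weight_ge0// ler_norml; exact: ratio_ge.
Qed.

Lemma shrinkage_gt_half x :
  (2^-1 < posterior_shrinkage 2^-1 L tau x) =
  (0 < \int[mu]_(t in D) excess x t).
Proof.
rewrite /posterior_shrinkage.
set N := Rintegral _ _ _; set W := Rintegral _ _ _; set E := Rintegral _ _ _.
have EE : N = 2^-1 * (E + W).
  have -> : E + W = \int[mu]_(t in D) (excess x t + w x t).
    by rewrite RintegralD.
  rewrite -RintegralZl//; last exact: integrable_add.
  apply: eq_Rintegral => t; rewrite inE/= in_itv/= andbT => t0.
  rewrite /excess; have s1 := s1_gt0 t0; field.
  by rewrite addrC gt_eqF.
have W0 : 0 <= W.
  apply: Rintegral_ge0 => t /=; rewrite in_itv/= andbT => t0.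
  exact: weight_ge0.
have EW : E <= W.
  apply: (le_Rintegral _ (integrable_excess x) (integrable_weight x)) => //.
  move=> t /=; rewrite in_itv/= andbT => t0.
  rewrite /excess ler_piMl ?weight_ge0//.
  by have /andP[] := ratio_ge t0.
(* If [W = 0], the quotient takes the default value 0 and [E <= W] gives [E <= 0], so both sides are
   false. *)
move: W0; rewrite le_eqVlt => /predU1P[W0|W0].
  rewrite -W0 invr0 mulr0 in EW *.
  by apply/idP/idP; lra.
by rewrite ltr_pdivlMr// EE ltr_pM2l// -[X in X < _]add0r ltrD2r.
Qed.

Lemma shrinkage_mono x y : `|x| <= `|y| ->
  2^-1 < posterior_shrinkage 2^-1 L tau x ->
  2^-1 < posterior_shrinkage 2^-1 L tau y.
Proof.
move=> xy hx.
have xy2 : x ^+ 2 <= y ^+ 2.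
  rewrite -(real_normK (num_real x)) -(real_normK (num_real y)).
  by rewrite lerXn2r ?nnegrE.
have Zl z : expR (z ^+ 2 / 4) * \int[mu]_(t in D) excess z t =
    \int[mu]_(t in D) (expR (z ^+ 2 / 4) * excess z t) by rewrite RintegralZl.
have Ex : 0 < \int[mu]_(t in D) (expR (x ^+ 2 / 4) * excess x t).
  by rewrite -Zl mulr_gt0 ?expR_gt0// -shrinkage_gt_half.
rewrite shrinkage_gt_half -(pmulr_rgt0 _ (expR_gt0 (y ^+ 2 / 4))) Zl.
apply: (lt_le_trans Ex).
apply: le_Rintegral => //; [exact: integrable_scale|exact: integrable_scale|].
move=> t /=; rewrite in_itv/= andbT => t0.
have s0 := s_gt0 t0; rewrite /excess !weightE /factor.
set s := t * tau ^+ 2 in s0 *.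
(* The two exponents add up to [z ^+ 2 * c / 4] with [c = (s - 1) / (s + 1)]. For either sign of
   [c], the product [c * expR (z ^+ 2 * c / 4)] is nondecreasing in [z ^+ 2]. *)
have E z : expR (z ^+ 2 / 4) *
   ((s - 1) / (s + 1) *
    ((1 + s) `^ (- 2^-1) * expR (- (z ^+ 2 / (2 * (1 + s)))) * p t)) =
   (1 + s) `^ (- 2^-1) * p t *
   ((s - 1) / (s + 1) * expR (z ^+ 2 * ((s - 1) / (s + 1)) / 4)).
  transitivity ((1 + s) `^ (- 2^-1) * p t *
   ((s - 1) / (s + 1) *
     (expR (z ^+ 2 / 4) * expR (- (z ^+ 2 / (2 * (1 + s))))))); first by ring.
  rewrite -expRD; congr (_ * (_ * expR _)); field.
  by rewrite !gt_eqF// addr_gt0.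
rewrite !E; apply: ler_wpM2l.
  by apply: mulr_ge0; [exact: powR_ge0|exact: p_ge0].
set c := (s - 1) / (s + 1). have [c0|c0] := leP 0 c.
  by rewrite ler_wpM2l// ler_expR ler_pM2r// ler_wpM2r.
apply: ler_wnM2l; first exact: ltW.
by rewrite ler_expR ler_pM2r//; apply: ler_wnM2r => //; exact: ltW.
Qed.

(** * Explicit sufficient conditions for rejection and for acceptance *)

Variables c0 t0 M : R.
Hypotheses (c0_gt0 : 0 < c0) (L_ge : forall t, t0 <= t -> c0 <= L t)
  (L_le : forall t, 0 < t -> L t <= M).

Let tau20 : 0 < tau ^+ 2. Proof. by rewrite exprn_gt0. Qed.

Let M_gt0 : 0 < M. Proof. exact: lt_le_trans (L0 ltr01) (L_le ltr01). Qed.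

Let indic_ocE (u v t : R) : \1_(`]u, v]) t = ((u < t) && (t <= v))%:R :> R.
Proof. by rewrite indicE mem_setE in_itv. Qed.

Let powR_ge (B t : R) : 0 < B -> 0 < t -> t <= B ^+ 2 ->
  (B ^+ 3)^-1 <= t `^ (- 2^-1 - 1).
Proof.
by move=> B0 t_gt0 tB; rewrite -powR_sqrN3//; apply: le0_ler_powR => //; lra.
Qed.

Let powR_le (B t : R) : 0 < B -> B ^+ 2 <= t ->
  t `^ (- 2^-1 - 1) <= (B ^+ 3)^-1.
Proof.
move=> B0 tB; rewrite -powR_sqrN3//.
by apply: le0_ler_powR => //; rewrite ?exprn_gt0//; lra.
Qed.

(* The integrand is at least a constant for x^2 < s <= 4 x^2, where the
   exponential is bounded below, and its negative part is at most
   exp (1/2 - x^2/2) times the prior for s <= 1/x^2, and at most a constant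
   of order tau^3 x^3 exp (- x^2/4) for 1/x^2 < s < 1. *)
Lemma shrinkage_gt_half_of x : 2 <= x -> t0 * tau ^+ 2 <= 1 ->
  expR (2^-1 - x ^+ 2 / 2) / K + M * x ^+ 3 * tau * expR (- (x ^+ 2 / 4)) <
    expR (- 1) * c0 * tau / (24 * x ^+ 2) ->
  2^-1 < posterior_shrinkage 2^-1 L tau x.
Proof.
move=> x2 t0tau small; rewrite shrinkage_gt_half.
have x0 : 0 < x by lra.
have x22 : 4 <= x ^+ 2 by nra.
(* The factors of [m] bound, for [x ^+ 2 < s <= 4 * x ^+ 2], the ratio [(s - 1) / (s + 1)], the
   power of [1 + s <= (3 * x) ^+ 2], the exponential, the power of [t <= (2 * x / tau) ^+ 2], and
   [L]. In [k], [1 + s <= 2] gives the exponential and [t >= (x * tau)^-1 ^+ 2] the cube. *)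
pose m := 3^-1 * ((3 * x)^-1 * expR (- 1) * (((2 * x / tau) ^+ 3)^-1 * c0)).
pose e := expR (2^-1 - x ^+ 2 / 2).
pose k := expR (- (x ^+ 2 / 4)) * ((x * tau) ^+ 3 * M).
have m0 : 0 <= m.
  rewrite !mulr_ge0 ?invr_ge0 ?expR_ge0 ?exprn_ge0 ?mulr_ge0 ?invr_ge0 ?ltW//.
have k0 : 0 <= k by rewrite !mulr_ge0 ?expR_ge0 ?exprn_ge0 ?mulr_ge0 ?ltW.
pose u := x ^+ 2 / tau ^+ 2.
(* Both negative bounds are extended past their own ranges: [e * p] to all of [D], where it
   integrates to [e / K], and [k] to all [s <= 1]. *)
pose l t := m * \1_(`]u, 4 * u]) t +
  (- e * p t + - k * \1_(`]0, (tau ^+ 2)^-1]) t).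
have u0 : 0 <= u by rewrite divr_ge0 ?sqr_ge0.
have il2 : mu.-integrable D
    (EFin \o (fun t => - e * p t + - k * \1_(`]0, (tau ^+ 2)^-1]) t)).
  apply: integrable_add => //; last exact: integrable_indic_oc.
  exact: integrable_scale.
have il : mu.-integrable D (EFin \o l).
  by apply: integrable_add => //; exact: integrable_indic_oc.
have intl : \int[mu]_(t in D) l t = expR (- 1) * c0 * tau / (24 * x ^+ 2) -
    (e / K + M * x ^+ 3 * tau * expR (- (x ^+ 2 / 4))).
  rewrite RintegralD//; last exact: integrable_indic_oc.
  rewrite RintegralD//; last 2 first.
  - exact: integrable_scale.
  - exact: integrable_indic_oc.
  rewrite (RintegralZl (- e) _ integrable_p)// Rintegral_p.
  rewrite !Rintegral_indic_oc ?invr_ge0 ?(ltW tau20)//; last by lra.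
  by rewrite /m /k /u; field; rewrite !gt_eqF.
apply: (@lt_le_trans _ _ (\int[mu]_(t in D) l t)).
  by rewrite intl subr_gt0.
apply: (le_Rintegral _ il (integrable_excess x)) => //.
move=> t /=; rewrite in_itv/= andbT => t_gt0.
have s0 := s_gt0 t_gt0; have p0 := p_ge0 t_gt0; have w0 := weight_ge0 x t_gt0.
have ep0 : 0 <= e * p t by rewrite mulr_ge0 ?expR_ge0.
rewrite /l !indic_ocE /u mulrA !ltr_pdivrMr// !ler_pdivlMr// t_gt0/=.
rewrite -[(tau ^+ 2)^-1]mul1r ler_pdivlMr//.
have [s1|s1] := ltP (t * tau ^+ 2) 1.
  have -> : (x ^+ 2 < t * tau ^+ 2) = false by apply/negbTE; rewrite -leNgt; lra.
  rewrite (ltW s1) mulr0 add0r mulr1.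
  have : - w x t <= excess x t.
    rewrite -mulN1r /excess ler_wpM2r//.
    by have /andP[] := ratio_ge t_gt0.
  apply: le_trans; rewrite mulNr -opprD lerN2 weightE.
  have fexp := factor_le_exp x t_gt0.
  have [sx|sx] := leP (t * tau ^+ 2 * x ^+ 2) 1.
    apply: ler_wpDr => //; rewrite ler_wpM2r//.
    apply: (le_trans fexp); rewrite ler_expR.
    (* Here [1 / (1 + s) >= 1 - s] and [s * x ^+ 2 <= 1]; this is the origin of the [2^-1] in
       [e]. *)
    suff : x ^+ 2 / 2 - 2^-1 <= x ^+ 2 / (2 * (1 + t * tau ^+ 2)) by lra.
    by rewrite ler_pdivlMr ?mulr_gt0 ?addr_gt0//; nra.
  apply: ler_wpDl => //; apply: ler_pM => //.
    apply: (le_trans fexp); rewrite ler_expR lerN2.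
    apply: ler_wpM2l; first exact: sqr_ge0.
    by rewrite lef_pV2 ?posrE; lra.
  apply: ler_pM; rewrite ?powR_ge0 ?L_le//; first exact/ltW/L0.
  have := @powR_le ((x * tau)^-1) t.
  rewrite !exprVn invrK; apply.
    by rewrite invr_gt0 mulr_gt0.
  rewrite -[leLHS]mul1r ler_pdivrMr ?exprn_gt0 ?mulr_gt0//.
  by rewrite exprMn; nra.
have e0 : 0 <= excess x t.
  by apply: mulr_ge0 => //; apply: divr_ge0; lra.
have r0 : - e * p t + - k * ((t * tau ^+ 2 <= 1)%R)%:R <= 0.
  by case: (t * tau ^+ 2 <= 1) => /=; lra.
apply: ler_wnDr => //.
case: andP => [[xs sx]|_]; last by rewrite mulr0.
rewrite mulr1 /m /excess weightE; apply: ler_pM.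
- by rewrite invr_ge0.
- by rewrite !mulr_ge0 ?invr_ge0 ?expR_ge0 ?exprn_ge0 ?mulr_ge0 ?invr_ge0
    ?(ltW x0) ?(ltW tau0) ?(ltW c0_gt0).
- by rewrite ler_pdivlMr; lra.
apply: ler_pM.
- by rewrite mulr_ge0 ?expR_ge0 ?invr_ge0 ?mulr_ge0
    ?(ltW x0) ?(ltW tau0) ?(ltW c0_gt0).
- by rewrite mulr_ge0 ?invr_ge0 ?exprn_ge0 ?mulr_ge0 ?invr_ge0
    ?(ltW x0) ?(ltW tau0) ?(ltW c0_gt0).
- apply: ler_pM; rewrite ?expR_ge0 ?invr_ge0 ?mulr_ge0
    ?(ltW x0) ?(ltW tau0) ?(ltW c0_gt0)//.
    rewrite -[leLHS]powR_sqrN ?mulr_gt0//; apply: le0_ler_powR; lra.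
  rewrite ler_expR lerN2 ler_pdivrMr; lra.
- apply: ler_pM; rewrite ?invr_ge0 ?exprn_ge0 ?mulr_ge0 ?invr_ge0
    ?(ltW x0) ?(ltW tau0) ?(ltW c0_gt0)//.
  - apply: powR_ge => //; first by rewrite divr_gt0 ?mulr_gt0.
    rewrite expr_div_n ler_pdivlMr//; lra.
  (* In this range [s > x ^+ 2 >= 4], whereas [t0 * tau ^+ 2 <= 1], so [t] exceeds [t0]. *)
  - apply: L_ge; nra.
Qed.

(* The positive part is at most a constant for 1 < s <= A and M / (tau t^2) for
   s > A; of the negative part only the range y^2 < t <= 4 y^2 is kept. *)
Lemma shrinkage_le_half_of x y A : 1 <= A -> 0 < y -> t0 <= y ^+ 2 ->
  8 * y ^+ 2 * tau ^+ 2 <= 1 ->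
  tau * (M * A * expR (- (x ^+ 2 / (2 * (1 + A)))) + M / A) <=
    expR (- (x ^+ 2 / 2)) * c0 / (16 * y) ->
  ~~ (2^-1 < posterior_shrinkage 2^-1 L tau x).
Proof.
move=> A1 y0 yt0 ytau small; rewrite shrinkage_gt_half -leNgt.
have A0 : 0 < A by lra.
have y20 : 0 < y ^+ 2 by rewrite exprn_gt0.
(* For [1 < s <= A] the exponential is largest at [s = A], and [t > tau^-1 ^+ 2] gives [tau ^+ 3].
   In [k], the hypothesis on [y] yields [s <= 1 / 2] for [t <= 4 * y ^+ 2], hence the factors [3^-1]
   and [2^-1]. *)
pose m := expR (- (x ^+ 2 / (2 * (1 + A)))) * (tau ^+ 3 * M).
pose k := 3^-1 * (2^-1 * expR (- (x ^+ 2 / 2)) * (((2 * y) ^+ 3)^-1 * c0)).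
have m0 : 0 <= m by rewrite !mulr_ge0 ?expR_ge0 ?exprn_ge0 ?ltW.
have k0 : 0 <= k.
  by rewrite !mulr_ge0 ?expR_ge0 ?invr_ge0 ?exprn_ge0 ?mulr_ge0 ?ltW.
pose v := (tau ^+ 2)^-1.
have v0 : 0 < v by rewrite invr_gt0.
pose h1 t := m * \1_(`]v, A * v]) t.
pose h2 t := (M / tau) * ((t ^+ 2)^-1 * \1_(`]A * v, +oo[) t).
pose h3 t := - k * \1_(`]y ^+ 2, 4 * y ^+ 2]) t.
have ih1 : mu.-integrable D (EFin \o h1) by exact: integrable_indic_oc.
have ih2 : mu.-integrable D (EFin \o h2).
  by apply: integrable_inv_sqr_above; rewrite mulr_gt0.
have ih3 : mu.-integrable D (EFin \o h3) by exact: integrable_indic_oc.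
have ih23 : mu.-integrable D (EFin \o (fun t => h2 t + h3 t)).
  exact: integrable_add.
apply: (@le_trans _ _ (\int[mu]_(t in D) (h1 t + (h2 t + h3 t)))); last first.
  have vAv : v <= A * v by rewrite ler_peMl// ltW.
  rewrite RintegralD// RintegralD// /h1 /h2 /h3.
  rewrite !Rintegral_indic_oc ?(ltW v0) ?(ltW y20)//; last by lra.
  rewrite Rintegral_inv_sqr_above ?mulr_gt0//.
  have Em : m * (A * v - v) <= tau * (M * A * expR (- (x ^+ 2 / (2 * (1 + A))))).
    rewrite (_ : tau * _ = m * (A * v)); last first.
      by rewrite /m /v; field; rewrite gt_eqF.
    by rewrite ler_wpM2l//; lra.
  have E2 : M / tau * (A * v)^-1 = tau * (M / A).
    by rewrite /v; field; rewrite !gt_eqF.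
  have Ek : k * (4 * y ^+ 2 - y ^+ 2) = expR (- (x ^+ 2 / 2)) * c0 / (16 * y).
    by rewrite /k; field; rewrite gt_eqF.
  by rewrite E2 mulNr Ek; rewrite mulrDr in small; lra.
apply: (le_Rintegral _ (integrable_excess x)) => //.
  exact: (integrable_add _ ih1 ih23).
move=> t /=; rewrite in_itv/= andbT => t_gt0.
have s0 := s_gt0 t_gt0; have p0 := p_ge0 t_gt0; have w0 := weight_ge0 x t_gt0.
rewrite /h1 /h2 /h3 !indic_ocE indicE mem_setE in_itv/= andbT.
have svE : (v < t) = (1 < t * tau ^+ 2).
  by rewrite /v -[_^-1]mul1r ltr_pdivrMr.
have AvE : (A * v < t) = (A < t * tau ^+ 2) by rewrite /v ltr_pdivrMr.
have ybound : t <= 4 * y ^+ 2 -> t * tau ^+ 2 <= 2^-1.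
  by move=> ty; have := ler_wpM2r (ltW tau20) ty; lra.
rewrite svE AvE (leNgt t (A * v)) AvE.
have [s1|s1] := leP (t * tau ^+ 2) 1.
  have -> : (A < t * tau ^+ 2) = false by apply/negbTE; rewrite -leNgt; lra.
  rewrite !mulr0 !add0r.
  have ex0 : excess x t <= 0.
    by apply: mulr_le0_ge0 => //; apply: mulr_le0_ge0; rewrite ?invr_ge0; lra.
  case: andP => [[yt ty]|_]; last by rewrite mulr0.
  have s12 := ybound ty.
  have exN : - excess x t =
      (1 - t * tau ^+ 2) / (t * tau ^+ 2 + 1) * (factor x t * p t).
    by rewrite /excess weightE -mulNr -mulNr opprB.
  rewrite mulr1 lerNr exN.
  apply: ler_pM.
  - by rewrite invr_ge0.
  - by rewrite !mulr_ge0 ?expR_ge0 ?invr_ge0 ?exprn_ge0 ?mulr_ge0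
    ?(ltW y0) ?(ltW tau0) ?(ltW c0_gt0).
  - by rewrite ler_pdivlMr; lra.
  apply: ler_pM.
  - by rewrite mulr_ge0 ?expR_ge0 ?invr_ge0.
  - by rewrite !mulr_ge0 ?invr_ge0 ?exprn_ge0 ?mulr_ge0
    ?(ltW y0) ?(ltW tau0) ?(ltW c0_gt0).
  - apply: ler_pM; rewrite ?expR_ge0 ?invr_ge0//.
      rewrite -[leLHS]powR_sqrN//; apply: le0_ler_powR; lra.
    rewrite ler_expR lerN2; apply: ler_wpM2l; first exact: sqr_ge0.
    by rewrite lef_pV2 ?posrE; lra.
  - apply: ler_pM; rewrite ?invr_ge0 ?exprn_ge0 ?mulr_ge0
    ?(ltW y0) ?(ltW tau0) ?(ltW c0_gt0)//.
      by apply: powR_ge => //; rewrite ?mulr_gt0// exprMn; lra.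
    by apply: L_ge; lra.
have -> : (t <= 4 * y ^+ 2) = false.
  by apply/negP => /ybound; lra.
rewrite andbF mulr0 addr0.
have exw : excess x t <= w x t.
  by rewrite /excess ler_piMl//; have /andP[] := ratio_ge t_gt0.
apply: (le_trans exw).
have [sA|sA] := leP (t * tau ^+ 2) A.
  rewrite /= !mulr0 addr0 mulr1 weightE.
  apply: ler_pM => //.
    apply: (le_trans (factor_le_exp x t_gt0)); rewrite ler_expR lerN2.
    apply: ler_wpM2l; first exact: sqr_ge0.
    by rewrite lef_pV2 ?posrE; lra.
  apply: ler_pM; rewrite ?powR_ge0 ?L_le//; first exact/ltW/L0.
  have := @powR_le tau^-1 t; rewrite !exprVn invrK; apply.
    by rewrite invr_gt0.
  by rewrite -[leLHS]mul1r ler_pdivrMr// ltW.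
rewrite /= mulr0 add0r mulr1 weightE.
(* Beyond [A], replacing [1 + s] by [s] merges the likelihood and prior powers into [t ^+ 2] in the
   denominator, the integrand of [h2]. *)
have st : (t * tau ^+ 2) `^ (- 2^-1) * t `^ (- 2^-1 - 1) = tau^-1 * (t ^+ 2)^-1.
  rewrite powRM ?ltW// powR_sqrN// mulrAC -powRD; last by rewrite (gt_eqF t_gt0) implybT.
  rewrite (_ : - 2^-1 + (- 2^-1 - 1) = - 2%:R); last by field.
  by rewrite powRN powR_mulrn ?ltW// mulrC.
rewrite (_ : M / tau * _ = (tau^-1 * (t ^+ 2)^-1) * M); last by ring.
rewrite -st -[leRHS]mulrA; apply: ler_pM => //.
  apply: (@le_trans _ _ ((1 + t * tau ^+ 2) `^ (- 2^-1))).
    by rewrite /factor ler_piMr ?powR_ge0// expR_s_le1.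
  by apply: le0_ler_powR; lra.
by rewrite ler_wpM2l ?powR_ge0// L_le.
Qed.

End posterior.

(** * Location of the threshold for large [n] *)

Section asymptotics.
Context {R : realType}.

(** Writing [expR (c * x)] as the power [k.+1] of [expR (c * x / k.+1%:R)] and bounding the latter
    below by its linear term leaves at most [B / x]. *)
Lemma cvg_exprn_expRN (k : nat) (c : R) : 0 < c ->
  x ^+ k * expR (- (c * x)) @[x --> +oo] --> (0 : R).
Proof.
move=> c0; pose B := (k.+1%:R / c) ^+ k.+1.
have B0 : 0 <= B by rewrite exprn_ge0// divr_ge0// ltW.
have cvB : B * x^-1 @[x --> +oo] --> (0 : R).
  rewrite -(mulr0 B); apply: cvgMr.
  by apply/gtr0_cvgV0; [near=> t; near: t; exact: nbhs_pinfty_gt|exact: cvg_id].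
apply: (squeeze_cvgr _ (cvg_cst 0) cvB).
near=> x; have x0 : 0 < x by near: x; exact: nbhs_pinfty_gt.
rewrite mulr_ge0 ?expR_ge0 ?exprn_ge0 ?(ltW x0)//=.
have h : (c * x / k.+1%:R) ^+ k.+1 <= expR (c * x).
  have -> : c * x = c * x / k.+1%:R *+ k.+1 by rewrite -mulr_natr divfK.
  rewrite -mulr_natr mulfK// expRM_natr lerXn2r ?nnegrE ?expR_ge0//.
    by rewrite divr_ge0// mulr_ge0 ?ltW.
  by apply: le_trans (expR_ge1Dx _); rewrite lerDr.
rewrite expRN ler_pdivrMr ?expR_gt0//; apply: le_trans (ler_wpM2l _ h); last first.
  by rewrite mulr_ge0 ?invr_ge0 ?(ltW x0).
rewrite le_eqVlt; apply/orP; left; apply/eqP.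
have aux (N : R) : N != 0 -> N / c * (c * x / N) = x.
  by move=> N0; field; rewrite N0 gt_eqF.
rewrite /B mulrAC -exprMn aux ?pnatr_eq0//.
by rewrite exprS mulrC mulKf// gt_eqF.
Unshelve. all: by end_near. Qed.

Variables (K : R) (L : R -> R).
Hypothesis prior : one_group_prior 2^-1 K L.
Variables c0 t0 M : R.
Hypotheses (c0_gt0 : 0 < c0) (t0_gt0 : 0 < t0)
  (L_ge : forall t, t0 <= t -> c0 <= L t)
  (L_le : forall t, 0 < t -> L t <= M).
Variables (C : R) (tau x rho : nat -> R).
Hypotheses (C0 : 0 < C) (tau_gt0 : forall n, 0 < tau n)
  (tau_cvg : tau n @[n --> \oo] --> (0 : R))
  (x_cvg : x n @[n --> \oo] --> +oo)
  (rhoE : \forall n \near \oo, expR (- (x n ^+ 2 / 2)) = rho n)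
  (tau_le : \forall n \near \oo, tau n <= 2 * C * rho n)
  (rho_le : \forall n \near \oo, rho n <= 2 / C * tau n).

Let M0 : 0 < M.
Proof. by apply: lt_le_trans (L_le ltr01); have [_ + _ _ _] := prior; exact. Qed.

Let K0 : 0 < K. Proof. by have [[]] := prior. Qed.

Let near_tau (e : R) : 0 < e -> \forall n \near \oo, tau n <= e.
Proof.
move=> e0; move/cvgrPdist_le : tau_cvg => /(_ _ e0); apply: filterS => n.
by rewrite sub0r normrN ger0_norm// ltW.
Qed.

Let near_exp (k : nat) (c e d : R) : 0 < c -> 0 < e ->
  \forall n \near \oo, (x n + d) ^+ k * expR (- (c * (x n + d))) < e.
Proof.
move=> c_gt0 e0.
have xd_cvg : x n + d @[n --> \oo] --> +oo.
  apply/cvgryPge => A; move/cvgryPge : x_cvg => /(_ (A - d)).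
  by apply: filterS => n; rewrite lerBlDr.
have := cvg_comp _ _ xd_cvg (cvg_exprn_expRN k c_gt0).
move=> /cvgrPdist_lt /(_ _ e0); apply: filterS => n /=.
by rewrite sub0r normrN; apply: le_lt_trans; exact: ler_norm.
Qed.

Let near_x (A : R) : \forall n \near \oo, A <= x n.
Proof. by move/cvgryPge : x_cvg; exact. Qed.

(** Since [tau n <= 2 * C * rho n], it suffices that the bracket multiplying [tau] in
    [shrinkage_le_half_of] is at most [c0 / (32 * y * C)]. A large fixed [A] makes [M / A] at most
    half of this; the exponential term then vanishes as [x n] grows. *)
Lemma near_shrinkage_le_half : \forall n \near \oo,
  ~~ (2^-1 < posterior_shrinkage 2^-1 L (tau n) (x n)).
Proof.
pose y := 1 + t0; have y0 : 0 < y by exact: addr_gt0.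
pose A := 1 + 64 * C * M * y / c0.
have A1 : 1 <= A.
  by rewrite lerDl divr_ge0 ?(ltW c0_gt0)// !mulr_ge0// ltW.
have A0 : 0 < A by lra.
have E0 : 0 < (2 * (1 + A))^-1 by rewrite invr_gt0; lra.
have e0 : 0 < c0 / (64 * y * C * M * A) by rewrite divr_gt0// !mulr_gt0.
have y1 : 0 < (8 * y ^+ 2)^-1 by rewrite invr_gt0 mulr_gt0 ?exprn_gt0.
near=> n.
have taun := tau_gt0 n.
apply: (shrinkage_le_half_of prior (tau_gt0 n) c0_gt0 L_ge L_le A1 y0).
- by rewrite /y; nra.
- have tau1 : tau n <= 1 by near: n; exact: near_tau.
  have tauy : tau n <= (8 * y ^+ 2)^-1 by near: n; exact: near_tau.
  rewrite -ler_pdivlMl ?mulr_gt0 ?exprn_gt0// mulr1.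
  by apply: le_trans tauy; rewrite expr2 ler_piMl// ltW.
have rn : expR (- (x n ^+ 2 / 2)) = rho n by near: n.
have rho0 : 0 < rho n by rewrite -rn expR_gt0.
have taur : tau n <= 2 * C * rho n by near: n.
rewrite rn.
have exA : expR (- (x n ^+ 2 / (2 * (1 + A)))) <= c0 / (64 * y * C * M * A).
  have x1 : 1 <= x n by near: n; exact: near_x.
  (* Once [x n >= 1], a quadratic exponent is dominated by a linear one, so [near_exp] applies with
     power and shift 0. *)
  have : (x n + 0) ^+ 0 * expR (- ((2 * (1 + A))^-1 * (x n + 0))) <
      c0 / (64 * y * C * M * A) by near: n; exact: near_exp.
  rewrite expr0 mul1r addr0 => /ltW; apply: le_trans; rewrite ler_expR lerN2 mulrC.
  have xx : x n <= x n ^+ 2 by nra.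
  by rewrite ler_pM2r.
have MA : M / A <= c0 / (64 * y * C).
  rewrite ler_pdivrMr// mulrAC ler_pdivlMr ?mulr_gt0//.
  have -> : c0 * A = c0 + M * (64 * y * C) by rewrite /A; field; rewrite gt_eqF.
  by rewrite lerDr ltW.
apply: (@le_trans _ _ (tau n * (c0 / (32 * y * C)))).
  rewrite ler_pM2l//.
  have : M * A * expR (- (x n ^+ 2 / (2 * (1 + A)))) <= c0 / (64 * y * C).
    apply: (le_trans (ler_wpM2l _ exA)); first by rewrite mulr_ge0 ?ltW.
    by rewrite le_eqVlt; apply/orP; left; apply/eqP; field; rewrite !gt_eqF.
  have -> : c0 / (32 * y * C) = c0 / (64 * y * C) + c0 / (64 * y * C).
    by field; rewrite !gt_eqF.
  by move=> h; exact: lerD.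
apply: (le_trans (ler_wpM2r _ taur)); first by rewrite divr_ge0 ?mulr_ge0 ?ltW.
by rewrite le_eqVlt; apply/orP; left; apply/eqP; field; rewrite !gt_eqF.
Unshelve. all: by end_near. Qed.

(** With [z = x n + e], completing the square gives [expR (- (z ^+ 2 / 2))] as [rho n] times a
    constant times [expR (- (e * z))]. As [rho n] is at most of order [tau n], this extra decay
    beats the [z ^+ 2] demanded by [shrinkage_gt_half_of]. *)
Lemma near_shrinkage_gt_half (e : R) : 0 < e -> \forall n \near \oo,
  2^-1 < posterior_shrinkage 2^-1 L (tau n) (x n + e).
Proof.
(* [B] gathers the constants left by completing the square, and [k] is the constant of the bound to
   beat; each of the two terms is allotted [k / 2]. *)
move=> e0; pose B := expR ((1 + e ^+ 2) / 2) * (2 / C) / K.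
pose k := expR (- 1) * c0 / 24 : R.
have B0 : 0 < B by rewrite !mulr_gt0 ?expR_gt0 ?invr_gt0.
have k0 : 0 < k by rewrite !mulr_gt0 ?expR_gt0.
have kB0 : 0 < k / (2 * B) by rewrite divr_gt0// mulr_gt0.
have kM0 : 0 < k / (2 * M) by rewrite divr_gt0// mulr_gt0.
have q0 : (0 : R) < 4^-1 by [].
near=> n; set z := x n + e.
have taun := tau_gt0 n.
have x2 : 2 <= x n by near: n; exact: near_x.
have z0 : 0 < z by rewrite /z; lra.
apply: (shrinkage_gt_half_of prior (tau_gt0 n) c0_gt0 L_ge L_le).
- by rewrite /z; lra.
- have tau1 : tau n <= 1 by near: n; exact: near_tau.
  have taut : tau n <= t0^-1 by near: n; apply: near_tau; rewrite invr_gt0.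
  rewrite mulrC -ler_pdivlMr// mul1r.
  by apply: le_trans taut; rewrite expr2 ler_piMl// ltW.
have h1 : z ^+ 2 * expR (- (e * z)) < k / (2 * B).
  by rewrite /z; near: n; exact: near_exp.
have h2 : z ^+ 5 * expR (- (4^-1 * z)) < k / (2 * M).
  by rewrite /z; near: n; exact: near_exp.
have rn : expR (- (x n ^+ 2 / 2)) = rho n by near: n.
have rt : rho n <= 2 / C * tau n by near: n.
have E1 : expR (2^-1 - z ^+ 2 / 2) / K <= B * tau n * expR (- (e * z)).
  have -> : 2^-1 - z ^+ 2 / 2 = - (x n ^+ 2 / 2) + ((1 + e ^+ 2) / 2 - e * z).
    by rewrite /z; field.
  rewrite expRD rn expRD.
  have -> : B * tau n * expR (- (e * z)) =
    (2 / C * tau n) * (expR ((1 + e ^+ 2) / 2) * expR (- (e * z))) / K.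
    by rewrite /B; ring.
  by rewrite ler_pM2r ?invr_gt0// ler_wpM2r// mulr_ge0 ?expR_ge0.
have E2 : expR (- (z ^+ 2 / 4)) <= expR (- (4^-1 * z)).
  have zz : z <= z ^+ 2 by rewrite /z; nra.
  by rewrite ler_expR lerN2 mulrC ler_pM2r.
rewrite ltr_pdivlMr ?mulr_gt0 ?exprn_gt0//.
have z20 : 0 < z ^+ 2 by rewrite exprn_gt0.
have S1 : B * tau n * expR (- (e * z)) * z ^+ 2 < tau n * (k / 2).
  rewrite (_ : _ * z ^+ 2 = tau n * (B * (z ^+ 2 * expR (- (e * z)))));
    last by ring.
  have -> : k / 2 = B * (k / (2 * B)) by field; rewrite gt_eqF.
  by rewrite ltr_pM2l// ltr_pM2l.
have S2 : M * z ^+ 3 * tau n * expR (- (z ^+ 2 / 4)) * z ^+ 2 < tau n * (k / 2).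
  rewrite (_ : _ * z ^+ 2 = tau n * (M * (z ^+ 5 * expR (- (z ^+ 2 / 4)))));
    last by ring.
  have -> : k / 2 = M * (k / (2 * M)) by field; rewrite gt_eqF.
  rewrite ltr_pM2l// ltr_pM2l//; apply: le_lt_trans h2.
  by rewrite ler_wpM2l// exprn_ge0// ltW.
have S1' : expR (2^-1 - z ^+ 2 / 2) / K * z ^+ 2 < tau n * (k / 2).
  by apply: le_lt_trans S1; rewrite ler_wpM2r// ltW.
have -> : expR (- 1) * c0 * tau n = 24 * (tau n * (k / 2) + tau n * (k / 2)).
  by rewrite /k; field.
rewrite mulrCA ltr_pM2l// mulrDl; exact: ltrD.
Unshelve. all: by end_near. Qed.

End asymptotics.

(** * Convergence of the normalized supremum risk *)

Lemma cvge0_bounded (R : realType) (u : nat -> \bar R) :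
  (forall e : R, 0 < e -> \forall n \near \oo,
    exists2 s : R, u n = s%:E & `|s| <= e) ->
  u n @[n --> \oo] --> 0%E.
Proof.
move=> h; apply/fine_cvgP; split.
  by apply: filterS (h 1 ltr01) => n [s -> _].
apply/cvgrPdist_le => e e0; apply: filterS (h e e0) => n [s us se].
by rewrite sub0r normrN /= us.
Qed.

Theorem theorem1 (R : realType)
  (d : nat -> measure_display) (T : forall n, measurableType (d n))
  (P : forall n, probability (T n) R)
  (eps : forall n, 'I_n -> {RV (P n) >-> R})
  (heps : forall n, iid_standard_normal (eps n))
  (q : nat -> nat) (hq0 : forall n, (0 < q n)%N)
  (hq : q n @[n --> \oo] --> \oo)
  (hqn : (q n)%:R / n%:R @[n --> \oo] --> (0 : R))
  (K : R) (L : R -> R) (hprior : one_group_prior 2^-1 K L)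
  (hA1 : exists c0 t0 : R,
     [/\ 0 < c0, 0 < t0 & forall t, t0 <= t -> c0 <= L t])
  (hA2 : exists M : R, 0 < M /\ forall t, 0 < t -> L t <= M)
  (tau : nat -> R) (htau0 : forall n, 0 < tau n)
  (htau : tau n @[n --> \oo] --> (0 : R))
  (C : R) (hC : 0 < C)
  (htauC : n%:R * tau n / (q n)%:R @[n --> \oo] --> C) :
  let normalized_sup_risk (n : nat) (b : R) : \bar R :=
    (((q n)%:R^-1)%:E *
     ereal_sup [set classification_risk (eps n)
                      (@shrinkage_rule R 2^-1 L (tau n) n) theta
               | theta in @beta_min_class R n (q n) b])%E in
  (forall b : R,
     (normalized_sup_risk n b - (1 - std_normal_cdf b)%:E)%E @[n --> \oo]
       --> (0 : \bar R)%E) /\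
  (forall b : nat -> R, b n @[n --> \oo] --> +oo ->
     (normalized_sup_risk n (b n) - (1 - std_normal_cdf (b n))%:E)%E
       @[n --> \oo] --> (0 : \bar R)%E).
Proof.
move: hA1 hA2 => [c0 [t0 [c0_gt0 t0_gt0 L_ge]]] [M [_ L_le]].
pose rho n : R := (q n)%:R / n%:R.
pose x n : R := Num.sqrt (2 * ln (n%:R / (q n)%:R)).
have n_gt0 : \forall n \near \oo, (0 < n)%N by exists 1%N.
have q_gt0 n : 0 < (q n)%:R :> R by rewrite ltr0n.
have rho_gt0 : \forall n \near \oo, 0 < rho n.
  by apply: filterS n_gt0 => n n0; rewrite divr_gt0// ltr0n.
have rho_lt (e : R) : 0 < e -> \forall n \near \oo, rho n < e.
  move=> e0; move/cvgrPdist_lt : hqn => /(_ _ e0); apply: filterS => n.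
  by rewrite sub0r normrN; apply: le_lt_trans; exact: ler_norm.
(* The bound [rho n < 1] makes the argument of the root nonnegative; at negative arguments
   [Num.sqrt] would return 0. *)
have x_sqr n : 0 < rho n -> rho n < 1 -> x n ^+ 2 = - 2 * ln (rho n).
  move=> r0 r1; rewrite /x (_ : _ / _ = (rho n)^-1); last by rewrite invf_div.
  rewrite lnV ?posrE// sqr_sqrtr; first by ring.
  by rewrite mulr_ge0// oppr_ge0 ln_le0// ltW.
have rhoE : \forall n \near \oo, expR (- (x n ^+ 2 / 2)) = rho n.
  apply: filterS2 rho_gt0 (rho_lt 1 ltr01) => n r0 r1.
  rewrite x_sqr// (_ : - _ = ln (rho n)); last by field.
  by rewrite lnK.
have x_cvg : x n @[n --> \oo] --> +oo.
  apply/cvgryPge => A.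
  apply: filterS3 rho_gt0 (rho_lt 1 ltr01)
    (rho_lt (expR (- (A ^+ 2 / 2))) (expR_gt0 _)) => n r0 r1.
  rewrite -ltr_ln ?posrE ?expR_gt0// expRK => rA.
  have [A0|A0] := leP A 0; first by rewrite (le_trans A0)// sqrtr_ge0.
  rewrite -(ler_pXn2r (n := 2)) ?nnegrE ?sqrtr_ge0 ?(ltW A0)//.
  by rewrite x_sqr//; lra.
have tauE : \forall n \near \oo, n%:R * tau n / (q n)%:R = tau n / rho n.
  apply: filterS n_gt0 => n n0; rewrite /rho; field.
  by rewrite !gt_eqF ?ltr0n.
have tau_le : \forall n \near \oo, tau n <= 2 * C * rho n.
  move/cvgrPdist_lt : htauC => /(_ _ hC) h.
  apply: filterS3 rho_gt0 tauE h => n r0 ->.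
  by rewrite ltr_distlC -ler_pdivrMr// => /andP[_]; lra.
have rho_le : \forall n \near \oo, rho n <= 2 / C * tau n.
  have C2 : 0 < C / 2 by rewrite divr_gt0.
  move/cvgrPdist_lt : htauC => /(_ _ C2) h.
  apply: filterS3 rho_gt0 tauE h => n r0 ->.
  rewrite ltr_distlC => /andP[h1 _].
  have : C / 2 < tau n / rho n by lra.
  rewrite ltr_pdivlMr// => h2.
  by rewrite mulrAC ler_pdivlMr// mulrC; lra.
move=> nsr.
(* Positivity of the boundary mean is the only condition placed on [b]. It holds eventually for
   constant [b] and for [b] tending to infinity, since [x n] diverges. *)
have main (b : nat -> R) : (\forall n \near \oo, 0 < x n + b n) ->
    (nsr n (b n) - (1 - std_normal_cdf (b n))%:E)%E @[n --> \oo]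
      --> (0 : \bar R)%E.
  move=> xb; apply: cvge0_bounded => e e0.
  (* Half of [e] pays for the overshoot of the threshold, the other half for the type I errors,
     which [x n >= 4 / e] makes small enough. *)
  have e20 : 0 < e / 2 by rewrite divr_gt0.
  have acc := near_shrinkage_le_half hprior c0_gt0 t0_gt0 L_ge L_le hC htau0
    htau x_cvg rhoE tau_le.
  have rej := near_shrinkage_gt_half hprior c0_gt0 t0_gt0 L_ge L_le hC htau0
    htau x_cvg rhoE rho_le e20.
  near=> n.
  have mono := shrinkage_mono hprior (htau0 n).
  have r0 : 0 < rho n by near: n.
  have r1 : rho n < 1 by near: n; exact: rho_lt.
  have n0 : 0 < n%:R :> R by rewrite ltr0n; near: n.
  have qn : (q n <= n)%N.
    by move: r1; rewrite ltr_pdivrMr// mul1r ltr_nat => /ltnW.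
  have x4 : 4 / e <= x n by near: n; move/cvgryPge : x_cvg; exact.
  have x0 : 0 < x n by apply: lt_le_trans x4; rewrite divr_gt0.
  have accn : ~~ (2^-1 < posterior_shrinkage 2^-1 L (tau n) (x n)) by near: n.
  have rejn : 2^-1 < posterior_shrinkage 2^-1 L (tau n) (x n + e / 2) by near: n.
  have xbn : 0 < x n + b n by near: n.
  have rn : expR (- (x n ^+ 2 / 2)) = rho n by near: n.
  have ub := threshold_sup_risk_le mono (heps n) (q := q n) (b n)
    x0 (ltW e20) accn rejn.
  have lb := threshold_sup_risk_ge mono (heps n) qn x0 xbn accn.
  rewrite -/(x n) rn in ub lb.
  rewrite /nsr; set S := ereal_sup _; set p := 1 - std_normal_cdf (b n) in ub lb *.
  have SS : S = (fine S)%:E.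
    rewrite fineK// fin_numElt; apply/andP; split.
      by apply: lt_le_trans lb; exact: ltNyr.
    by apply: le_lt_trans ub _; exact: ltry.
  exists ((q n)%:R^-1 * fine S - p); first by rewrite SS.
  move: ub lb; rewrite -/S SS !lee_fin => ub lb.
  have qn0 := q_gt0 n.
  have xe : (x n)^-1 <= e / 4.
    by rewrite -[e / 4]invrK lef_pV2 ?posrE ?invr_gt0 ?divr_gt0// invf_div.
  rewrite ler_norml; apply/andP; split.
  - rewrite lerBrDr ler_pdivlMl//; apply: le_trans lb.
    rewrite ler_pM2l//.
    have rx : rho n / x n <= (x n)^-1.
      by rewrite ler_piMl ?invr_ge0 ?(ltW x0) ?(ltW r1).
    by clear -rx xe e0; lra.
  - rewrite lerBlDr ler_pdivrMl//; apply: (le_trans ub).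
    (* As [n%:R * rho n] equals [q n], the type I errors of all [n] coordinates total at most
       [2 / x n] per signal. *)
    rewrite [X in X + _](_ : _ = (q n)%:R * (2 * (x n)^-1)); last first.
      by rewrite /rho; field; rewrite !gt_eqF.
    by rewrite -mulrDr ler_pM2l//; clear -xe; lra.
split => [b|b b_cvg]; apply: main.
- move/cvgryPgt : x_cvg => /(_ (- b)); apply: filterS => n; lra.
- move/cvgryPgt : x_cvg => /(_ 0) h; move/cvgryPgt : b_cvg => /(_ 0).
  by apply: filterS2 h => n; lra.
Unshelve. all: by end_near. Qed.
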